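(* Let $G$ be a finite simple graph, and let $U$ be a set of three vertices of $G$ such that the induced subgraph $G[U]$ is isomorphic to the path $P_3$ on three vertices. Then there exists a vertex $u \in U$ such that $s^-(G) > s^-(G \setminus \{u\}) + 1$. Likewise, there exists a vertex $u' \in U$ such that $s^+(G) > s^+(G \setminus \{u'\}) + 1$.
   Context: For a finite simple graph $G$ with adjacency matrix eigenvalues $\lambda_1 \geq \cdots \geq \lambda_n$, $s^+(G) = \sum_{i:\lambda_i \geq 0} \lambda_i^2$ and $s^-(G) = \sum_{i:\lambda_i \leq 0} \lambda_i^2$. $G \setminus \{u\}$ denotes the subgraph induced by all vertices except $u$. *)

(* Defs.v *)
From HB Require Import structures.
From mathcomp Require Import all_boot all_order all_algebra.
From mathcomp Require Import polyrcf complex spectral.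

Set Implicit Arguments.
Unset Strict Implicit.
Unset Printing Implicit Defensive.

Import Order.TTheory GRing.Theory Num.Theory.
Local Open Scope ring_scope.

Record sgraph := SGraph {
  vertex :> finType;
  edge : rel vertex;
  edge_sym : symmetric edge;
  edge_irr : irreflexive edge }.

Section Induced.
Variables (G : sgraph) (S : {set G}).
Let e (x y : {x : G | x \in S}) := edge (val x) (val y).
Fact induced_sym : symmetric e.
Proof. by move=> x y; exact: edge_sym. Qed.
Fact induced_irr : irreflexive e.
Proof. by move=> x; exact: edge_irr. Qed.
Definition induced : sgraph := SGraph induced_sym induced_irr.
End Induced.

Definition delete_vertex (G : sgraph) (u : G) : sgraph := induced [set~ u].

Section PathGraph.
Variable n : nat.
Let e (i j : 'I_n) := (i.+1 == j) || (j.+1 == i).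
Fact path_graph_sym : symmetric e.
Proof. by move=> i j; rewrite /e orbC. Qed.
Fact path_graph_irr : irreflexive e.
Proof. by move=> i; rewrite /e orbb (gtn_eqF (ltnSn i)). Qed.
(* Indexed by the number of vertices: [path_graph 3] is P_3. *)
Definition path_graph : sgraph := SGraph path_graph_sym path_graph_irr.
End PathGraph.

Definition isomorphic (G H : sgraph) : Prop :=
  exists2 f : G -> H, bijective f & forall x y, edge (f x) (f y) = edge x y.

Section SquareEnergy.
Variables (R : rcfType) (G : sgraph).

Definition adj_mx : 'M[R]_#|G| :=
  \matrix_(i, j) (edge (enum_val i) (enum_val j))%:R.

(* Nonincreasing list of the roots in R of the characteristic polynomial, each
   repeated according to its multiplicity. [adj_eigenvaluesP] and
   [size_adj_eigenvalues] show that no eigenvalue is missing. *)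
Definition adj_eigenvalues : seq R :=
  let p := char_poly adj_mx in
  sort >=%R (flatten [seq nseq (mup x p) x | x <- rootsR p]).

Definition s_plus : R := \sum_(x <- adj_eigenvalues | 0 <= x) x ^+ 2.
Definition s_minus : R := \sum_(x <- adj_eigenvalues | x <= 0) x ^+ 2.

Lemma char_poly_adj_split :
  exists s : seq R, char_poly adj_mx = \prod_(x <- s) ('X - x%:P).
Proof.
pose f := real_complex R; pose B := map_mx f adj_mx.
have Bh : B \is hermsymmx.
  apply: realsym_hermsym.
    apply/is_hermitianmxP; rewrite expr0 scale1r map_mx_id //.
    by apply/matrixP => i j; rewrite !mxE edge_sym.
  by apply/mxOverP => i j; rewrite !mxE complex_real.
have /orthomx_spectralP BE := hermitian_normalmx Bh.
have /mxOverP Dr := hermitian_spectral_diag_real Bh.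
have Uu := spectral_unit B.
exists [seq complex.Re (spectral_diag B 0 i) | i <- enum 'I_#|G|].
apply: (map_poly_inj f); rewrite map_char_poly -/B big_map rmorph_prod /=.
have -> : char_poly B = char_poly (diag_mx (spectral_diag B)).
  set U := spectralmx B in BE Uu *; set D := diag_mx _ in BE *.
  have UB : U *m B = D *m U by rewrite {1}BE !mulmxA mulmxV // mul1mx.
  have detU : \det (map_mx polyC U) != 0.
    by rewrite det_map_mx polyC_eq0 -unitfE -unitmxE.
  apply: (mulfI detU); rewrite [RHS]mulrC /char_poly -!det_mulmx.
  rewrite /char_poly_mx mulmxBl mulmxBr.
  by rewrite -!map_mxM UB scalar_mxC.
rewrite char_poly_trig ?diag_mx_is_trig // big_enum /=; apply: eq_bigr => i _.
rewrite rmorphB /= map_polyX map_polyC /= mxE eqxx mulr1n.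
by congr (_ - _%:P); apply/esym/RRe_real/Dr.
Qed.

Lemma adj_eigenvaluesP :
  char_poly adj_mx = \prod_(x <- adj_eigenvalues) ('X - x%:P).
Proof.
have [s ps] := char_poly_adj_split; rewrite {1}ps; apply: perm_big.
have p0 : char_poly adj_mx != 0 by rewrite monic_neq0 ?char_poly_monic.
rewrite perm_sym /adj_eigenvalues perm_sort; apply/allP => x _ /=.
have xE : (x \in rootsR (char_poly adj_mx)) = (0 < count_mem x s)%N.
  by have := roots_on_rootsR p0 x; rewrite in_itv /= => <-;
    rewrite ps root_prod_XsubC -has_pred1 has_count.
apply/eqP; rewrite count_flatten -map_comp sumnE big_map.
rewrite (eq_bigr (fun y => (y == x) * count_mem x s)%N); last first.
  move=> y _ /=; rewrite count_nseq /=; case: eqP => [->|] //.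
  by rewrite !mul1n ps mu_prod_XsubC.
rewrite -big_distrl /=; case: (posnP (count_mem x s)) => [->|c0].
  by rewrite muln0.
rewrite -[RHS]mul1n; congr (_ * _)%N.
rewrite -big_mkcond sum1_count count_uniq_mem ?xE ?c0 //.
exact: (sorted_uniq lt_trans ltxx (sorted_roots _ _ _)).
Qed.

Lemma size_adj_eigenvalues : size adj_eigenvalues = #|G|.
Proof.
have := size_char_poly adj_mx.
by rewrite adj_eigenvaluesP size_prod_XsubC => -[].
Qed.
End SquareEnergy.

(* Main.v *)
Require Import Defs.
From HB Require Import structures.
From mathcomp Require Import all_boot all_order all_algebra.
From mathcomp Require Import complex spectral.
From mathcomp Require Import ring lra.

Set Implicit Arguments.
Unset Strict Implicit.
Unset Printing Implicit Defensive.

Import Order.TTheory GRing.Theory Num.Theory.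
Local Open Scope ring_scope.
Local Open Scope sesquilinear_scope.

(* [s_minus R G] is the squared Frobenius distance from the adjacency matrix
   [A] to the cone of positive semidefinite matrices, attained at the positive
   part [P]; write [A = P - N]. Deleting row and column [u] of [P] gives a
   competitor for the vertex-deleted graph, so [s_minus] drops by at least the
   squared norm of the entries of [N] in row or column [u]. If the drop were at
   most 1 at each vertex of an induced path, the corresponding 3 x 3 block of
   [N] would be too small for [P = A + N] to be positive semidefinite.
   For [s_plus], replace [A] by [-A]. *)

(** * Gram matrices and the Frobenius norm *)

(** Positive semidefiniteness as a factorization; the free row count [m] lets the real and imaginary
    parts of a complex factor be stacked. *)
Definition gram (R : comNzRingType) n (M : 'M[R]_n) :=
  exists m (Q : 'M[R]_(m, n)), M = Q^T *m Q.

Definition sqnorm (R : comNzRingType) m n (M : 'M[R]_(m, n)) : R :=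
  \sum_i \sum_j M i j ^+ 2.

Lemma gram_sym (R : comNzRingType) n (M : 'M[R]_n) : gram M -> M^T = M.
Proof. by case=> k [Q ->]; rewrite trmx_mul trmxK. Qed.

Lemma gram_mxsub (R : comNzRingType) m n (g : 'I_m -> 'I_n) (M : 'M[R]_n) :
  gram M -> gram (mxsub g g M).
Proof.
case=> k [Q ->]; exists k, (colsub g Q).
by apply/matrixP=> i j; rewrite !mxE; apply: eq_bigr => l _; rewrite !mxE.
Qed.

Lemma gram_form_ge0 (R : realDomainType) n (M : 'M[R]_n) (v : 'rV[R]_n) :
  gram M -> 0 <= (v *m M *m v^T) 0 0.
Proof.
case=> k [Q ->]; rewrite mulmxA -mulmxA -[X in X *m _]trmxK trmx_mul trmxK.
by rewrite mxE sumr_ge0 // => i _; rewrite !mxE -expr2 sqr_ge0.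
Qed.

(** * Unitary invariance of the Frobenius norm *)

Section Unitary.
Variables (C : numClosedFieldType) (n : nat).
Implicit Types (U X : 'M[C]_n).

Lemma mxtrace_mul_conjmx m (X : 'M[C]_m) :
  \tr (X *m X^t*) = \sum_i \sum_j `|X i j| ^+ 2.
Proof.
apply: eq_bigr => i _; rewrite mxE; apply: eq_bigr => j _.
by rewrite !mxE normCK.
Qed.

Lemma mxtrace_unitary_conj U X : U \is unitarymx ->
  \tr ((U^t* *m X *m U) *m (U^t* *m X *m U)^t*) = \tr (X *m X^t*).
Proof.
move=> uU; rewrite !trmx_mul !map_mxM trmxCK !mulmxA /=.
by rewrite mulmxtVK // -!mulmxA mxtrace_mulC !mulmxA mulmxtVK.
Qed.

End Unitary.

(** * Real symmetric matrices and their distance to the positive semidefinite cone *)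

Section RealSymmetric.
Variable R : rcfType.
Local Notation toC := (real_complex R).

Lemma sqnorm_toC n (X : 'M[R]_n) :
  toC (sqnorm X) = \tr (map_mx toC X *m (map_mx toC X)^t*).
Proof.
rewrite mxtrace_mul_conjmx rmorph_sum; apply: eq_bigr => i _ /=.
rewrite rmorph_sum; apply: eq_bigr => j _ /=.
by rewrite !mxE rmorphXn /= real_normK // complex_real.
Qed.

(** The spectral theorem is applied over [R[i]]: the diagonal is real because [A] is Hermitian, so
    it is read back in [R], while [U] stays complex. *)
Lemma real_spectral n (A : 'M[R]_n) : A^T = A ->
  exists (U : 'M[R[i]]_n) (r : 'rV[R]_n),
    [/\ U \is unitarymx,
        map_mx toC A = U^t* *m diag_mx (map_mx toC r) *m U
      & char_poly A = \prod_i ('X - (r 0 i)%:P)].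
Proof.
move=> symA; set B := map_mx toC A.
have Bh : B \is hermsymmx.
  apply: realsym_hermsym; last first.
    by apply/mxOverP => i j; rewrite !mxE complex_real.
  apply/is_hermitianmxP; rewrite expr0 scale1r map_mx_id //.
  by rewrite map_trmx symA.
have /orthomx_spectralP := hermitian_normalmx Bh.
have /mxOverP Dr := hermitian_spectral_diag_real Bh.
have uU := spectral_unitarymx B; rewrite invmx_unitary //.
move: (spectralmx B) (spectral_diag B) Dr uU => U d Dr uU BE.
pose r := map_mx (@complex.Re R) d.
have rE : map_mx toC r = d.
  by apply/matrixP => i j; rewrite !mxE; apply/RRe_real/Dr.
exists U, r; split; rewrite ?rE //.
apply: (map_poly_inj toC); rewrite map_char_poly -/B rmorph_prod /=.
have UB : U *m B = diag_mx d *m U.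
  by rewrite BE !mulmxA (unitarymxP uU) mul1mx.
have detU : \det (map_mx polyC U) != 0.
  by rewrite det_map_mx polyC_eq0 -unitfE -unitmxE unitarymx_unit.
transitivity (char_poly (diag_mx d)).
  (* Multiplying by the nonzero [\det U] reduces similarity to the intertwining relation [UB]. *)
  apply: (mulfI detU); rewrite [RHS]mulrC /char_poly -!det_mulmx.
  by rewrite /char_poly_mx mulmxBl mulmxBr -!map_mxM UB scalar_mxC.
rewrite char_poly_trig ?diag_mx_is_trig //; apply: eq_bigr => i _.
by rewrite rmorphB /= map_polyX map_polyC /= -rE !mxE eqxx mulr1n.
Qed.

Section Decomposed.
Variables (n : nat) (A : 'M[R]_n) (U : 'M[R[i]]_n) (r : 'rV[R]_n).
Hypotheses (uU : U \is unitarymx)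
  (AE : map_mx toC A = U^t* *m diag_mx (map_mx toC r) *m U).

(** In the eigenbasis of [A], [M] has diagonal entries [w >= 0], so [r - w] is at least as large as
    [r] in absolute value where [r <= 0]. The other entries of the difference are dropped. *)
Lemma sqnorm_sub_gram_ge (M : 'M[R]_n) : gram M ->
  \sum_(i | r 0 i <= 0) r 0 i ^+ 2 <= sqnorm (A - M).
Proof.
case=> k [Q ME]; rewrite -lecR sqnorm_toC.
have uV : U^t* \is unitarymx by rewrite trmxC_unitary.
rewrite -(mxtrace_unitary_conj _ uV) trmxCK mxtrace_mul_conjmx.
set Y := (_ *m _ *m _).
pose V := map_mx toC Q *m U^t*.
have YE : Y = diag_mx (map_mx toC r) - V^t* *m V.
  rewrite /Y map_mxB mulmxBr mulmxBl AE !mulmxA (unitarymxP uU) mul1mx.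
  rewrite mulmxtVK //; congr (_ - _).
  rewrite ME map_mxM /V trmx_mul map_mxM trmxCK !mulmxA.
  congr (_ *m _ *m _ *m _).
  by apply/matrixP => i j; rewrite !mxE [RHS]conj_Creal // complex_real.
rewrite rmorph_sum big_mkcond; apply: ler_sum => i _ /=.
rewrite (bigD1 i) //= ler_wpDr //.
  by rewrite sumr_ge0 // => j _; rewrite exprn_ge0.
case: ifP => [ri|_]; last by rewrite exprn_ge0.
have w0 : 0 <= (V^t* *m V) i i.
  by rewrite mxE sumr_ge0 // => l _; rewrite !mxE mulrC mul_conjC_ge0.
have rC : toC (r 0 i) <= 0 by rewrite (lecR _ 0).
rewrite YE !mxE eqxx mulr1n rmorphXn /=.
move: w0; rewrite !mxE; set w := \sum_(_ < _) _ => w0.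
rewrite -real_normK ?complex_real // lerXn2r ?nnegrE //.
by rewrite !ler0_norm // ?opprB ?lerDl ?lerDr // subr_le0 (le_trans rC).
Qed.

(** Write the product as [V^t* *m V] with [V = X + iY]: its real part is [X^T *m X + Y^T *m Y], the
    Gram matrix of [X] stacked on [Y]. *)
Lemma gram_Re_unitary_conj (w : 'rV[R]_n) : (forall i, 0 <= w 0 i) ->
  gram (map_mx (@complex.Re R) (U^t* *m diag_mx (map_mx toC w) *m U)).
Proof.
move=> w0; pose V := diag_mx (map_mx (toC \o Num.sqrt) w) *m U.
exists (n + n)%N.
exists (col_mx (map_mx (@complex.Re R) V) (map_mx (@complex.Im R) V)).
have -> : U^t* *m diag_mx (map_mx toC w) *m U = V^t* *m V.
  rewrite /V trmx_mul map_mxM tr_diag_mx map_diag_mx !mulmxA.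
  rewrite -[in RHS](mulmxA _ (diag_mx _)) mulmx_diag.
  congr (_ *m diag_mx _ *m _).
  apply/rowP => i; rewrite !mxE /= conj_Creal ?complex_real // -rmorphM /=.
  by rewrite -expr2 sqr_sqrtr.
rewrite tr_col_mx mul_row_col; apply/matrixP => i j; rewrite !mxE.
have ReD : {morph @complex.Re R : x y / x + y} by case=> ? ? [].
rewrite (big_morph _ ReD erefl) -big_split /=; apply: eq_bigr => k _.
rewrite !mxE; case: (\sum_(_ < _) _) => ? ?; case: (\sum_(_ < _) _) => ? ? /=.
by rewrite mulNr opprK.
Qed.

(** Taking real parts shrinks every entry, and unitary conjugation preserves the norm of the
    diagonal matrix. *)
Lemma sqnorm_Re_unitary_conj (w : 'rV[R]_n) :
  sqnorm (map_mx (@complex.Re R) (U^t* *m diag_mx (map_mx toC w) *m U))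
  <= \sum_i w 0 i ^+ 2.
Proof.
rewrite -lecR; set H := (_ *m U).
apply: (@le_trans _ _ (\tr (H *m H^t*))).
  rewrite mxtrace_mul_conjmx rmorph_sum; apply: ler_sum => i _ /=.
  rewrite rmorph_sum; apply: ler_sum => j _ /=; rewrite !mxE -add_Re2_Im2 lecR.
  by rewrite lerDl sqr_ge0.
rewrite mxtrace_unitary_conj // mxtrace_mul_conjmx rmorph_sum.
apply: ler_sum => i _ /=; rewrite (bigD1 i) //= big1 => [|j /negPf ij].
  by rewrite addr0 !mxE eqxx mulr1n rmorphXn /= real_normK ?complex_real.
by rewrite !mxE eq_sym ij mulr0n normr0 expr0n.
Qed.

Lemma gram_sub_gram : exists P N : 'M[R]_n,
  [/\ gram P, gram N, A = P - N
    & sqnorm N <= \sum_(i | r 0 i <= 0) r 0 i ^+ 2].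
Proof.
pose p := map_mx (Num.max 0) r; pose q := map_mx (fun x => Num.max 0 (- x)) r.
pose H w := map_mx (@complex.Re R) (U^t* *m diag_mx (map_mx toC w) *m U).
exists (H p), (H q); split.
- by apply: gram_Re_unitary_conj => i; rewrite mxE le_max lexx.
- by apply: gram_Re_unitary_conj => i; rewrite mxE le_max lexx.
- have rE : r = p - q.
    apply/rowP => i; rewrite !mxE; case: (leP 0 (r 0 i)) => ri.
      by rewrite max_l ?oppr_le0 // subr0.
    by rewrite max_r ?oppr_ge0 ?ltW // sub0r opprK.
  (* [A] is its own real part, so additivity of [Re] carries [r = p - q] over to the matrices. *)
  have -> : A = map_mx (@complex.Re R) (map_mx toC A).
    by apply/matrixP => i j; rewrite !mxE.
  rewrite AE {1}rE map_mxB raddfB /= mulmxBr mulmxBl.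
  apply/matrixP => i j; rewrite !mxE.
  by case: (\sum_(_ < _) _) => ? ?; case: (\sum_(_ < _) _).
- apply: le_trans (sqnorm_Re_unitary_conj _) _.
  rewrite [leRHS]big_mkcond; apply: ler_sum => i _; rewrite mxE.
  case: (leP (r 0 i) 0) => ri; first by rewrite max_r ?oppr_ge0 // sqrrN.
  by rewrite max_l ?expr0n /= ?lexx ?oppr_le0 ?(ltW ri).
Qed.

End Decomposed.
End RealSymmetric.

(* [e] is the squared Frobenius distance from [A] to the cone of positive
   semidefinite matrices. *)
Definition sqdist_gram (R : rcfType) n (A : 'M[R]_n) (e : R) : Prop :=
  (exists P N : 'M[R]_n, [/\ gram P, gram N, A = P - N & sqnorm N <= e]) /\
  (forall M, gram M -> e <= sqnorm (A - M)).

(** * Square energies as distances, and vertex deletion *)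

Section SquareEnergyDistance.
Variables (R : rcfType) (G : sgraph).

Lemma adj_mx_sym : (adj_mx R G)^T = adj_mx R G.
Proof. by apply/matrixP => i j; rewrite !mxE edge_sym. Qed.

Lemma adj_eigenvalues_perm (r : 'rV[R]_#|G|) :
  char_poly (adj_mx R G) = \prod_i ('X - (r 0 i)%:P) ->
  perm_eq (adj_eigenvalues R G) [seq r 0 i | i : 'I_#|G|].
Proof.
move=> chi; apply: prod_XsubC_eq; rewrite -adj_eigenvaluesP chi.
by rewrite big_map big_enum.
Qed.

Lemma s_minus_sqdist : sqdist_gram (adj_mx R G) (s_minus R G).
Proof.
have [U [r [uU AE /adj_eigenvalues_perm rP]]] := real_spectral adj_mx_sym.
rewrite /s_minus (perm_big _ rP) big_map big_enum_cond /=; split.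
  exact: gram_sub_gram uU AE.
exact: sqnorm_sub_gram_ge uU AE.
Qed.

(** Negating [A] keeps [U] and negates [r]: nonnegative eigenvalues become nonpositive, with the
    same squares. *)
Lemma s_plus_sqdist : sqdist_gram (- adj_mx R G) (s_plus R G).
Proof.
have [U [r [uU AE /adj_eigenvalues_perm rP]]] := real_spectral adj_mx_sym.
rewrite /s_plus (perm_big _ rP) big_map big_enum_cond /=.
have AEN : map_mx (real_complex R) (- adj_mx R G) =
    U^t* *m diag_mx (map_mx (real_complex R) (- r)) *m U.
  by rewrite map_mxN AE map_mxN raddfN /= mulmxN mulNmx.
rewrite (eq_big (fun i => (- r) 0 i <= 0) (fun i => (- r) 0 i ^+ 2)).
- split; [exact: gram_sub_gram uU AEN | exact: sqnorm_sub_gram_ge uU AEN].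
- by move=> i; rewrite mxE oppr_le0.
- by move=> i _; rewrite mxE sqrrN.
Qed.

Definition delete_index (u : G) (i : 'I_#|delete_vertex u|) : 'I_#|G| :=
  enum_rank (val (enum_val i)).

Lemma adj_mx_delete u :
  adj_mx R (delete_vertex u) =
    mxsub (@delete_index u) (@delete_index u) (adj_mx R G).
Proof. by apply/matrixP => i j; rewrite !mxE !enum_rankK. Qed.

Lemma sum_delete_index u (F : 'I_#|G| -> R) :
  \sum_i F (@delete_index u i) = \sum_(x | x != u) F (enum_rank x).
Proof.
rewrite (eq_bigl (mem [set~ u])) => [|x]; last by rewrite !inE.
rewrite (big_sub (mem [set~ u]) (fun x => F (enum_rank x))).
by rewrite (reindex _ (onW_bij _ (@enum_val_bij (delete_vertex u)))).
Qed.

Lemma sqnorm_delete (N : 'M[R]_#|G|) (u v w : G) :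
  let n x y := N (enum_rank x) (enum_rank y) in
  N^T = N -> u != v -> u != w -> v != w ->
  sqnorm (mxsub (@delete_index u) (@delete_index u) N) +
    (n u u ^+ 2 + 2 * n u v ^+ 2 + 2 * n u w ^+ 2) <= sqnorm N.
Proof.
move=> n symN uv uw vw.
have nC x y : n x y = n y x by rewrite /n -[in LHS]symN mxE.
have -> : sqnorm N = \sum_x \sum_y n x y ^+ 2.
  rewrite /sqnorm (reindex _ (onW_bij _ (@enum_rank_bij G))).
  apply: eq_bigr => x _.
  by rewrite (reindex _ (onW_bij _ (@enum_rank_bij G))).
have -> : sqnorm (mxsub (@delete_index u) (@delete_index u) N) =
    \sum_(x | x != u) \sum_(y | y != u) n x y ^+ 2.
  pose F i := \sum_(y | y != u) N i (enum_rank y) ^+ 2.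
  rewrite /sqnorm -(sum_delete_index u F) /F.
  apply: eq_bigr => i _; rewrite -(sum_delete_index u (fun j => N _ j ^+ 2)).
  by apply: eq_bigr => j _; rewrite mxE.
have row_ge : n u v ^+ 2 + n u w ^+ 2 <= \sum_(y | y != u) n u y ^+ 2.
  rewrite (bigD1 v) 1?eq_sym //= (bigD1 w) /=; last by rewrite eq_sym uw eq_sym.
  by rewrite addrA lerDl sumr_ge0 // => y _; rewrite sqr_ge0.
(* Split off row [u], then column [u] from the other rows; by symmetry [row_ge] bounds both, whence
   the factors 2. *)
rewrite [leRHS](bigD1 u) //= [X in _ <= X + _](bigD1 u) //=.
under [X in _ <= _ + X]eq_bigr => x _ do rewrite (bigD1 u) //= nC.
by rewrite big_split /=; lra.
Qed.

End SquareEnergyDistance.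

(* [c = 1] or [-1], and [aa, .., ac] are the entries of [N] on the path; the
   first inequality tests [c A + N] on the vector [(1, -2 c, 1)]. It
   contradicts the three others, added with weights [1, 4, 1], by
   Cauchy-Schwarz. *)
Lemma path_entries_contra (R : realFieldType) (c aa bb cc ab bc ac : R) :
  c ^+ 2 = 1 ->
  0 <= aa + 4 * bb + cc + 2 * ac - 4 * c * (ab + c + (bc + c)) ->
  aa ^+ 2 + 2 * ab ^+ 2 + 2 * ac ^+ 2 <= 1 ->
  bb ^+ 2 + 2 * ab ^+ 2 + 2 * bc ^+ 2 <= 1 ->
  cc ^+ 2 + 2 * ac ^+ 2 + 2 * bc ^+ 2 <= 1 -> False.
Proof.
move=> c2 L Wa Wb Wc.
have sq x : 0 <= x ^+ 2 :> R by exact: sqr_ge0.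
(* A variable with coefficient [l] in the linear form and [q] in the weighted sum of squares is
   centred at [t * l / q]. Here [t = 3/4] is close to the optimal [sqrt (10/17)]; the linear form is
   then at most 7.825, while 8 is required. *)
have := (sq (aa - 3/4), sq (cc - 3/4), sq (bb - 3/4), sq (ac - 3/8)).
have := (sq (ab + c * (3/10)), sq (bc + c * (3/10))).
move=> [Sab Sbc] [[[Saa Scc] Sbb] Sac].
move: L Sab Sbc; rewrite !sqrrD !exprMn c2; nra.
Qed.

(** Leaving the sign [c] and the energy [S] abstract lets one argument serve both [s_minus] and
    [s_plus]. *)
Lemma exists_sqdist_drop (R : rcfType) (G : sgraph) (U : {set G}) (c : R)
    (S : sgraph -> R) :
  isomorphic (induced U) (path_graph 3) -> c ^+ 2 = 1 ->
  (forall H, sqdist_gram (c *: adj_mx R H) (S H)) ->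
  exists u : G, u \in U /\ S G > S (delete_vertex u) + 1.
Proof.
move=> [f [g fK gK] f_edge] c2 SP.
pose p k : G := val (g (inord k)).
have pU k : p k \in U by exact: valP.
have pE i j : (i < 3)%N -> (j < 3)%N ->
    edge (p i) (p j) = (i.+1 == j) || (j.+1 == i).
  by move=> i3 j3; rewrite -[LHS]f_edge !gK /= !inordK.
have p_neq i j : (i < 3)%N -> (j < 3)%N -> i != j -> p i != p j.
  move=> i3 j3; apply: contraNneq => /val_inj/(can_inj gK)/(congr1 val).
  by rewrite /= !inordK // => ->.
case: (SP G) => -[P [N [gP gN AE leN]]] _.
pose n x y := N (enum_rank x) (enum_rank y).
have nC x y : n x y = n y x by rewrite /n -[in LHS](gram_sym gN) mxE.
have drop u v w : u != v -> u != w -> v != w ->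
    S (delete_vertex u) + (n u u ^+ 2 + 2 * n u v ^+ 2 + 2 * n u w ^+ 2) <= S G.
  move=> uv uw vw; apply: le_trans leN.
  apply: le_trans (sqnorm_delete (gram_sym gN) uv uw vw); rewrite lerD2r.
  (* The submatrix of [P] competes for the deleted graph, with residual the submatrix of [- N]. *)
  have [_ /(_ _ (gram_mxsub (@delete_index G u) gP))] := SP (delete_vertex u).
  congr (_ <= _); apply: eq_bigr => i _; apply: eq_bigr => j _.
  move/matrixP: AE => /(_ (delete_index i) (delete_index j)).
  by rewrite adj_mx_delete !mxE => ->; rewrite addrAC subrr sub0r sqrrN.
have PE x y : P (enum_rank x) (enum_rank y) = c * (edge x y)%:R + n x y.
  move/matrixP: AE => /(_ (enum_rank x) (enum_rank y)).
  by rewrite !mxE !enum_rankK => ->; rewrite subrK.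
pose e x : 'rV[R]_#|G| := delta_mx 0 (enum_rank x).
(* The coefficient 2 stands in for the [sqrt 2] in the eigenvector of [c A] on the path for
   [- sqrt 2]. *)
pose v := e (p 0%N) + - (2 * c) *: e (p 1%N) + e (p 2%N).
have := gram_form_ge0 v gP.
have -> : (v *m P *m v^T) 0 0 =
    n (p 0%N) (p 0%N) + 4 * c ^+ 2 * n (p 1%N) (p 1%N) + n (p 2%N) (p 2%N)
    + 2 * n (p 0%N) (p 2%N)
    - 4 * c * (n (p 0%N) (p 1%N) + c + (n (p 1%N) (p 2%N) + c)).
  pose q x y := e x *m P *m (e y)^T.
  have qE x y : q x y 0 0 = c * (edge x y)%:R + n x y.
    by rewrite -PE /q trmx_delta -rowE -colE !mxE.
  rewrite /v !(mulmxDl, mulmxDr, linearD, linearZ) /= -!scalemxAl -!/(q _ _).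
  (* Making [q] opaque keeps [mxE] from expanding the products. *)
  move: (q) qE => {}q qE.
  rewrite !mxE !qE !pE //=.
  rewrite (nC (p 1%N) (p 0%N)) (nC (p 2%N) (p 0%N)) (nC (p 2%N) (p 1%N)).
  ring.
rewrite c2 mulr1 => form_ge0.
have p01 : p 0%N != p 1%N by exact: p_neq.
have p02 : p 0%N != p 2%N by exact: p_neq.
have p12 : p 1%N != p 2%N by exact: p_neq.
(* If no vertex of the path works, all three drops are at most 1. *)
case: (ltP (S (delete_vertex (p 0%N)) + 1) (S G)) => [|S0].
  by exists (p 0%N).
case: (ltP (S (delete_vertex (p 1%N)) + 1) (S G)) => [|S1].
  by exists (p 1%N).
case: (ltP (S (delete_vertex (p 2%N)) + 1) (S G)) => [|S2].
  by exists (p 2%N).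
have d0 := drop _ _ _ p01 p02 p12.
have := drop (p 1%N) (p 0%N) (p 2%N); rewrite eq_sym => /(_ p01 p12 p02) d1.
have := drop (p 2%N) (p 0%N) (p 1%N).
rewrite eq_sym [p 2%N == p 1%N]eq_sym => /(_ p02 p12 p01).
move: d1; rewrite (nC (p 1%N) (p 0%N)).
rewrite (nC (p 2%N) (p 0%N)) (nC (p 2%N) (p 1%N)).
by move=> d1 d2; case: (path_entries_contra c2 form_ge0); lra.
Qed.

Theorem theorem1p10 (R : rcfType) (G : sgraph) (U : {set G})
    (cardU : #|U| = 3%N) (UP3 : isomorphic (induced U) (path_graph 3)) :
  (exists u : G, u \in U /\ s_minus R G > s_minus R (delete_vertex u) + 1) /\
  (exists u' : G, u' \in U /\ s_plus R G > s_plus R (delete_vertex u') + 1).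
Proof.
split.
  apply: (exists_sqdist_drop (c := 1) (S := s_minus R) UP3).
    by rewrite expr1n.
  by move=> H; rewrite scale1r; apply: s_minus_sqdist.
apply: (exists_sqdist_drop (c := -1) (S := s_plus R) UP3).
  by rewrite sqrrN expr1n.
by move=> H; rewrite scaleN1r; apply: s_plus_sqdist.
Qed.
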